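(* Let $n\ge 1$, let $\lambda$ be an $n$-partition, let $\pi\in S_n$, and let $T\in\mathcal{T}_\lambda$. Then $S(T)\le Y_\lambda(\pi)$ if and only if $T(l,k)\in B_\lambda(T,\pi;l,k)$ for all $(l,k)\in\lambda$.
   Context: Notation. Fix $n\ge 1$. For integers $p,q$, $[p,q]=\{p,p+1,\dots,q\}$ (empty if $p>q$). An $n$-partition is $\lambda=(\lambda_1\ge\dots\ge\lambda_n\ge 0)$, integers. Its shape has $\lambda_i$ left-justified boxes in row $i$ (row 1 at the top). The box in column $j$ and row $i$ is written $(j,i)\in\lambda$ (column index first). The column lengths are $\zeta_1,\dots,\zeta_{\lambda_1}$. A semistandard tableau $T$ of shape $\lambda$ is a filling with values $T(j,i)\in[1,n]$ such that $T(j,i)\le T(j+1,i)$ and $T(j,i)<T(j,i+1)$; $\mathcal{T}_\lambda$ is the set of these. For tableaux of the same shape, $T\le U$ means $T(j,i)\le U(j,i)$ for all boxes. Keys. $S_n$ is the set of $n$-tuples $\pi=(\pi_1,\dots,\pi_n)$ with distinct entries from $[1,n]$. The $\lambda$-key $Y_\lambda(\pi)$ is the tableau of shape $\lambda$ whose $j$th column consists of $\pi_1,\dots,\pi_{\zeta_j}$ sorted increasingly from top to bottom; $Y_\lambda(\pi;j,i)$ is its entry at $(j,i)$. Scanning tableau. The earliest weakly increasing subsequence (EWIS) of a sequence $(x_1,x_2,\dots)$ is $(x_{i_1},x_{i_2},\dots)$ with $i_1=1$ and, for $j>1$, $i_j$ minimal with $i_j>i_{j-1}$ and $x_{i_{j-1}}\le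 x_{i_j}$. For $1\le l\le\lambda_1$, let $T^{(l,\zeta_l)}$ be $T$ with its first $l-1$ columns removed (column indexing retained). For $k=\zeta_l,\zeta_l-1,\dots,1$: read the bottom values of the nonempty columns of $T^{(l,k)}$ from left to right (starting with column $l$, whose bottom is at $(l,k)$), take the EWIS of this sequence, let the scanning path $P(T;l,k)$ be the sequence of locations of this EWIS, and let $S(T;l,k)$ be the last value of this EWIS; then let $T^{(l,k-1)}$ be the (semistandard) tableau obtained from $T^{(l,k)}$ by removing the boxes of $P(T;l,k)$. The scanning tableau $S(T)$ is the filling of $\lambda$ with value $S(T;l,k)$ at $(l,k)$. The sets $B$. For $(l,k)\in\lambda$ and $j\le l$ there is exactly one $i\in[1,\zeta_j]$ with $(l,k)\in P(T;j,i)$. For $1\le j\le l-1$: let $a(j)$ be the row index with $(l-1,k)\in P(T;j,a(j))$; if $k<\zeta_l$ let $b(j)$ be the row index with $(l,k+1)\in P(T;j,b(j))$, and if $k=\zeta_l$ let $b(j):=\zeta_j+1$. For $a(j)\le i\le b(j)-1$, let $h$ be the largest index less than $l$ such that $(h,r)\in P(T;j,i)$ for some $r$, and set $E(l,k;j,i):=T(h,r)$. For $j=l$ set $a(l):=b(l)-1:=k$ and $E(l,k;l,k):=k$. Then $$B_\lambda(T,\pi;l,k):=\bigcap_{j=1}^{l}\Big(\bigcup_{i=a(j)}^{b(j)-1}[E(l,k;j,i),\,Y_\lambda(\pi;j,i)]\Big).$$ *)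

(* Defs.v *)
(* Columns and rows are numbered from 1, and the box in column j and row i is
   the pair (j, i), column first.  Partitions and n-tuples are sequences,
   whose entry number i (from 1) is  nth 0 _ i.-1. *)
From mathcomp Require Import all_boot.

Set Implicit Arguments.
Unset Strict Implicit.
Unset Printing Implicit Defensive.

Section Scanning.

Variable n : nat.

Definition is_partition (lam : n.-tuple nat) : bool := sorted geq lam.

Definition in_Sn (pi : n.-tuple nat) : bool :=
  uniq pi && all (fun x => 0 < x <= n) pi.

Variable lam : n.-tuple nat.

(* lambda_1 *)
Definition ncols : nat := nth 0 lam 0.

Definition box (j i : nat) : bool :=
  [&& 0 < j, 0 < i & j <= nth 0 lam i.-1].

Definition zeta (j : nat) : nat := count (leq j) lam.

(* A filling is a function of the column and the row; its values outside the
   shape are irrelevant. *)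
Definition filling := nat -> nat -> nat.

Definition semistandard (T : filling) : Prop :=
  [/\ forall j i, box j i -> 0 < T j i <= n,
      forall j i, box j i -> box j.+1 i -> T j i <= T j.+1 i
    & forall j i, box j i -> box j i.+1 -> T j i < T j i.+1].

Definition tab_le (T U : filling) : Prop :=
  forall j i, box j i -> T j i <= U j i.

Definition key (pi : n.-tuple nat) : filling :=
  fun j i => nth 0 (sort leq (take (zeta j) pi)) i.-1.

(* Earliest weakly increasing subsequence, for sequences of items whose values
   are given by v.  [ewis_after v x s] is what follows the chosen item x when s
   is the rest of the sequence. *)
Fixpoint ewis_after (A : Type) (v : A -> nat) (x : A) (s : seq A) : seq A :=
  if s is y :: s' then
    if v x <= v y then y :: ewis_after v y s' else ewis_after v x s'
  else [::].

Definition ewis (A : Type) (v : A -> nat) (s : seq A) : seq A :=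
  if s is x :: s' then x :: ewis_after v x s' else [::].

Variable T : filling.

Definition value (p : nat * nat) : nat := T p.1 p.2.

(* Every box removed by the scanning is the bottom of its column, so the tableau
   that remains is the restriction of T to the boxes (h, 1), ..., (h, c h), for
   a function c of column heights. *)
Definition bottoms (l : nat) (c : nat -> nat) : seq (nat * nat) :=
  [seq (h, c h) | h <- index_iota l ncols.+1 & 0 < c h].

Definition scan_step (l : nat) (c : nat -> nat) : nat -> nat :=
  let P := ewis value (bottoms l c) in
  fun h => if (h, c h) \in P then (c h).-1 else c h.

(* Column heights of T^(l,k), for k <= zeta_l. *)
Definition heights (l k : nat) : nat -> nat :=
  iter (zeta l - k) (scan_step l) (fun h => if l <= h then zeta h else 0).

Definition scan_path (l k : nat) : seq (nat * nat) :=
  ewis value (bottoms l (heights l k)).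

Definition scanning : filling :=
  fun l k => value (last (0, 0) (scan_path l k)).

(* The i in [1, zeta_j] such that p lies on P(T; j, i). *)
Definition path_row (j : nat) (p : nat * nat) : nat :=
  (find (fun i => p \in scan_path j i) (iota 1 (zeta j))).+1.

Definition a_ (l k j : nat) : nat :=
  if j == l then k else path_row j (l.-1, k).

Definition b_ (l k j : nat) : nat :=
  if j == l then k.+1
  else if k < zeta l then path_row j (l, k.+1) else (zeta j).+1.

(* The columns increase along a scanning path, so the last box of the filtered
   path is the one in the largest column h < l. *)
Definition E_ (l k j i : nat) : nat :=
  if j == l then k
  else value (last (0, 0) [seq p <- scan_path j i | p.1 < l]).

(* index_iota p q lists the integers p, ..., q - 1. *)
Definition B_ (pi : n.-tuple nat) (l k : nat) : pred nat := fun x =>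
  all (fun j => has (fun i => E_ l k j i <= x <= key pi j i)
                    (index_iota (a_ l k j) (b_ l k j)))
      (index_iota 1 l.+1).

End Scanning.

(* Main.v *)
(** Fix [j].  The scanning paths starting in column [j] partition the boxes of
    the columns [>= j], and a path has weakly increasing values, so
    [S(T) <= Y] means that every box [(l, k)] satisfies [T(l,k) <= Y(j, r)] for
    all [j <= l], where [r = r_j(l, k)] is the row index of the path through
    [(l, k)].  While the paths [i] with [a(j) <= i < b(j)] are scanned,
    downwards in [i], the bottom of column [l] is [(l, k)] until it is removed,
    and path [i] removes it as soon as its last value [E(l,k;j,i)] before column
    [l] is at most [T(l, k)].  Hence [r] is the largest such [i] in
    [[a(j), b(j) - 1]], and since [Y(j, i)] increases with [i], [T(l, k)] lies
    in the [j]th union of intervals iff [T(l, k) <= Y(j, r)]. *)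

Require Import Defs.
From mathcomp Require Import all_boot.

(** * Earliest weakly increasing subsequences *)

Section Ewis.

Set Implicit Arguments.
Unset Strict Implicit.

Variables (A : eqType) (v : A -> nat).
Implicit Types (x y z : A) (s : seq A).

Lemma subseq_ewis_after x s : subseq (ewis_after v x s) s.
Proof.
elim: s x => [|y s IHs] x //=.
case: ifP => _; first by rewrite eqxx.
exact: subseq_trans (IHs x) (subseq_cons _ _).
Qed.

Lemma subseq_ewis s : subseq (ewis v s) s.
Proof. by case: s => [|x s] //=; rewrite eqxx subseq_ewis_after. Qed.

Lemma mem_ewis_after x s : {subset ewis_after v x s <= s}.
Proof. exact/mem_subseq/subseq_ewis_after. Qed.

Lemma mem_ewis s : {subset ewis v s <= s}.
Proof. exact/mem_subseq/subseq_ewis. Qed.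

(** The greedy choice remembers only the last chosen item, so in [t] it resumes from that item. *)
Lemma ewis_cat x s t :
  ewis v ((x :: s) ++ t) =
  ewis v (x :: s) ++ ewis_after v (last x (ewis v (x :: s))) t.
Proof.
rewrite /=; congr (_ :: _).
by elim: s x => [|y s IHs] x //=; case: ifP => _ //=; rewrite IHs.
Qed.

Lemma sorted_ewis s : sorted (relpre v leq) (ewis v s).
Proof.
case: s => [|x s] //=.
by elim: s x => [|y s IHs] x //=; case: ifP => //= ->; apply: IHs.
Qed.

Lemma mem_last_of x0 s x : x \in s -> last x0 s \in s.
Proof. by case: s => //= y s _; apply: mem_last. Qed.

(** Serves for two orders: by value along a path, and by column, with [fst] for [v]. *)
Lemma sorted_le_last x0 s x :
  sorted (relpre v leq) s -> x \in s -> v x <= v (last x0 s).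
Proof.
case: s => [|y s] //=.
elim: s x y => [|z s IHs] x y /=; first by rewrite mem_seq1 => _ /eqP->.
case/andP=> le_yz sP; rewrite inE => /predU1P[->|]; last exact: IHs.
by apply: leq_trans le_yz _; apply: IHs; rewrite ?mem_head.
Qed.

End Ewis.

Section Scan.

Set Implicit Arguments.
Unset Strict Implicit.

Variables (n : nat) (lam : n.-tuple nat) (T : filling).
Hypotheses (lamP : is_partition lam) (ssT : semistandard lam T).

Local Notation zeta := (zeta lam).
Local Notation box := (box lam).
Local Notation value := (value T).
Local Notation scan_step := (scan_step lam T).
Local Notation heights := (heights lam T).
Local Notation scan_path := (scan_path lam T).
Local Notation path_row := (path_row lam T).

(** * Row lengths and column lengths of the shape *)

Lemma boxE j i : box j i = [&& 0 < j, 0 < i & i <= zeta j].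
Proof.
rewrite /Defs.box /Defs.zeta; case: j => [|j] //=; case: i => [|i] //=.
have: sorted geq lam := lamP.
elim: (tval lam) i => [|x s IHs] i /=; first by rewrite nth_nil.
have tr : transitive geq by move=> ? ? ? /= h1 h2; apply: leq_trans h1.
rewrite (path_sortedE tr) => /andP[/allP le_s s_sorted].
(* The parts decrease weakly, so once one part misses a column, all later parts do. *)
have count0 : x < j.+1 -> count (leq j.+1) s = 0.
  move=> lt_xj; apply/eqP; rewrite -leqn0 leqNgt -has_count.
  by apply/hasPn => y /le_s le_yx; rewrite -ltnNge; apply: leq_ltn_trans lt_xj.
case: i => [|i] /=; last rewrite IHs //.
  by case: (ltnP j x) => // /count0->.
by case: (ltnP j x) => // /count0->.
Qed.

Lemma zeta_anti j l : j <= l -> zeta l <= zeta j.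
Proof. by move=> le_jl; apply: sub_count => x /=; apply: leq_trans. Qed.

Lemma zeta_gt0 j : 0 < j -> (0 < zeta j) = (j <= ncols lam).
Proof. by move=> j_gt0; have := boxE j 1; rewrite /Defs.box j_gt0 /= => <-. Qed.

(** Columns increase strictly from a value at least 1. This gives the lower end of the single
    interval for [j = l]. *)
Lemma row_le_value l k : box l k -> k <= T l k.
Proof.
have [_ _ col_lt] := ssT; case: k => [|k] //.
elim: k => [|k IHk] bk; first by have [/(_ _ _ bk)/andP[]] := ssT.
have bk' : box l k.+1.
  by move: bk; rewrite !boxE => /and3P[-> _ /ltnW].
by apply: leq_trans (col_lt _ _ bk' bk); apply: IHk.
Qed.

(** * Column heights while paths are removed *)

Definition shape_from j (c : nat -> nat) : Prop :=
  [/\ forall h, h < j -> c h = 0, forall h, c h <= zeta h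
    & forall h, j <= h -> c h.+1 <= c h].

Lemma shape_from_anti j c h : shape_from j c -> j <= h -> c h <= c j.
Proof.
move=> [_ _ c_anti] /subnKC<-.
elim: (h - j) => [|d IHd]; first by rewrite addn0.
by rewrite addnS; apply: leq_trans (c_anti _ (leq_addr _ _)) IHd.
Qed.

Lemma mem_bottoms j c h k :
  ((h, k) \in bottoms lam j c) = [&& j <= h, h <= ncols lam, k == c h & 0 < k].
Proof.
apply/mapP/and4P => [[h']|[le_jh le_hn /eqP-> c_gt0]].
  rewrite mem_filter mem_index_iota ltnS.
  by case/and3P=> c_gt0 le_jh le_hn [-> ->]; rewrite le_jh le_hn eqxx.
by exists h; rewrite ?mem_filter ?mem_index_iota ?c_gt0 ?le_jh.
Qed.

Lemma sorted_bottoms j c : sorted (relpre fst leq) (bottoms lam j c).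
Proof.
rewrite /bottoms sorted_map; apply: sorted_filter; last exact: iota_sorted.
by move=> ? ? ?; apply: leq_trans.
Qed.

(** Column [l] is decided by one comparison, with the last item chosen before it; such an item
    exists because column [j] is nonempty. *)
Lemma mem_ewis_bottoms j c l :
  0 < c j -> j < l <= ncols lam -> 0 < c l ->
  let P := ewis value (bottoms lam j c) in
  ((l, c l) \in P) =
  (value (last (0, 0) [seq p <- P | p.1 < l]) <= T l (c l)).
Proof.
move=> cj /andP[lt_jl le_ln] cl P0; rewrite {}/P0.
have -> : bottoms lam j c =
    ((j, c j) :: [seq (h, c h) | h <- index_iota j.+1 l & 0 < c h]) ++
    ((l, c l) ::
       [seq (h, c h) | h <- index_iota l.+1 (ncols lam).+1 & 0 < c h]).
  rewrite /bottoms -{1}(subnKC (ltnW lt_jl)) /index_iota.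
  have -> : (ncols lam).+1 - j = (l - j) + ((ncols lam) - l).+1.
    by rewrite -subSn // addnC addnBA ?(ltnW lt_jl) // subnK // leqW.
  rewrite iotaD filter_cat map_cat subnKC ?(ltnW lt_jl) // subSS.
  have -> : l - j = (l - j.+1).+1 by rewrite subnS prednK // subn_gt0.
  by rewrite /= cj cl.
set s := [seq _ | h <- index_iota j.+1 l & _]; set t := [seq _ | h <- _ & _].
rewrite ewis_cat; set P := ewis _ _.
have P_lt p : p \in P -> p.1 < l.
  move/mem_ewis; rewrite inE => /predU1P[-> //|/mapP[h]].
  by rewrite mem_filter mem_index_iota => /and3P[_ _ lt_hl] ->.
have t_gt p : p \in t -> l < p.1.
  by case/mapP=> h; rewrite mem_filter mem_index_iota => /and3P[_ lt_lh _] ->.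
have notPl : (l, c l) \notin P by apply/negP => /P_lt; rewrite ltnn.
have nottl x : (l, c l) \notin ewis_after value x t.
  by apply/negP => /mem_ewis_after/t_gt; rewrite ltnn.
rewrite mem_cat (negbTE notPl) orFb filter_cat.
have -> : [seq p <- P | p.1 < l] = P by apply/all_filterP/allP.
(* Everything chosen from here on lies in columns at least [l], so the filter leaves nothing of
   it. *)
rewrite [X in P ++ X](_ : _ = [::]) ?cats0; last first.
  apply/eqP; rewrite -[_ == _]negbK -has_filter; apply/hasPn => p.
  move=> /(@mem_ewis_after _ value _ ((l, c l) :: t)); rewrite -leqNgt inE.
  by case/predU1P=> [->//|/t_gt/ltnW].
rewrite -[last (j, c j) P]/(last (0, 0) P) /=.
by case: ifP => _; rewrite ?mem_head ?(negbTE (nottl _)).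
Qed.

(** The heights could stop decreasing only where column [h] loses its bottom and column [h.+1] has
    the same height. Rows increase weakly, so [h.+1] then loses its bottom too. *)
Lemma scan_step_shape j c :
  0 < j -> shape_from j c -> shape_from j (scan_step j c).
Proof.
move=> j_gt0 [c_out c_zeta c_anti].
have le_step h : scan_step j c h <= c h.
  by rewrite /Defs.scan_step; case: ifP => // _; apply: leq_pred.
split=> [h lt_hj|h|h le_jh].
- by apply/eqP; rewrite -leqn0 -(c_out h).
- exact: leq_trans (c_zeta h).
rewrite {2}/Defs.scan_step; case: ifP => [hP|_]; last first.
  exact: leq_trans (c_anti h _).
have: (h, c h) \in bottoms lam j c by apply: mem_ewis hP.
rewrite mem_bottoms => /and4P[_ le_hn _ c_gt0].
have [lt|ge] := ltnP (c h.+1) (c h).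
  by apply: leq_trans (le_step _) _; rewrite -ltnS prednK.
have eq_c : c h.+1 = c h by apply/eqP; rewrite eqn_leq c_anti.
suff: (h.+1, c h.+1) \in ewis value (bottoms lam j c).
  by rewrite /Defs.scan_step => ->; rewrite eq_c.
have c1_gt0 : 0 < c h.+1 by rewrite eq_c.
have bh1 : box h.+1 (c h.+1) by rewrite boxE c1_gt0 c_zeta.
have le_h1n : h.+1 <= ncols lam.
  by rewrite -zeta_gt0 //; apply: leq_trans (c_zeta _).
have cj_gt0 : 0 < c j.
  by apply: leq_trans c_gt0 _; apply: shape_from_anti le_jh; split.
rewrite mem_ewis_bottoms //; last by rewrite ltnS le_jh.
set F := [seq _ <- _ | _].
have hF : (h, c h) \in F by rewrite mem_filter ltnS leqnn.
have bh : box h (c h) by rewrite boxE c_gt0 c_zeta (leq_trans j_gt0).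
have [_ row_le _] := ssT.
(* Columns increase along the path, and [F] keeps those up to [h], so its last box is the one in
   column [h]. *)
suff -> : last (0, 0) F = (h, c h).
  by rewrite eq_c in bh1 *; apply: row_le.
have le_h : h <= (last (0, 0) F).1.
  apply: (sorted_le_last (v := fst) _ _ hF).
  have tr : transitive (relpre (@fst nat nat) leq).
    by move=> ? ? ?; apply: leq_trans.
  apply: sorted_filter => //; apply: subseq_sorted (subseq_ewis _ _) _ => //.
  exact: sorted_bottoms.
have : last (0, 0) F \in F by apply: (mem_last_of _ hF).
case: (last _ _) le_h => h' k' /= le_h.
rewrite mem_filter ltnS => /andP[ge_h /mem_ewis].
rewrite mem_bottoms => /and4P[_ _ /eqP-> _].
by have -> : h' = h by apply/eqP; rewrite eqn_leq ge_h.
Qed.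

Lemma head_mem_ewis_bottoms j c :
  0 < c j -> j <= ncols lam -> (j, c j) \in ewis value (bottoms lam j c).
Proof.
move=> c_gt0 le_jn; rewrite /bottoms /index_iota subSn //= c_gt0.
exact: mem_head.
Qed.

(** Each path starts at the bottom of column [j] and so takes exactly one box from it; hence [k] is
    both the index of the path and the row where it starts. *)
Lemma heights_shape j k :
  0 < j -> k <= zeta j -> shape_from j (heights j k) /\ heights j k j = k.
Proof.
move=> j_gt0 le_k; rewrite /Defs.heights -{3}(subKn le_k).
elim: (zeta j - k) (leq_subr k (zeta j)) => [_|m IHm lt_m].
  split; last by rewrite /= leqnn subn0.
  split=> [h|h|h le_jh] /=; first by rewrite ltnNge => /negbTE->.
    by case: ifP.
  by rewrite le_jh leqW // zeta_anti.
have [shm cmj] := IHm (ltnW lt_m).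
rewrite iterS; split; first exact: scan_step_shape.
rewrite /Defs.scan_step head_mem_ewis_bottoms ?cmj ?subn_gt0 ?subnS //.
by rewrite -zeta_gt0 //; apply: leq_ltn_trans lt_m.
Qed.

(** Indices run downwards: [heights j i.+1] is the state before path [i.+1] is removed,
    [heights j i] the state after. *)
Lemma heightsS j i h : i < zeta j ->
  heights j i h = if (h, heights j i.+1 h) \in scan_path j i.+1
                  then (heights j i.+1 h).-1 else heights j i.+1 h.
Proof.
by move=> lt_i; rewrite [LHS]/Defs.heights -subnSK.
Qed.

Lemma heights_mono j h i i' :
  i <= i' <= zeta j -> heights j i h <= heights j i' h.
Proof.
case/andP=> /subnKC<-; elim: (i' - i) => [|d IHd]; first by rewrite addn0.
rewrite addnS => lt_d; apply: leq_trans (IHd (ltnW lt_d)) _.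
by rewrite heightsS //; case: ifP => // _; apply: leq_pred.
Qed.

(** * Boxes and the paths through them *)

Lemma mem_scan_path j i h k :
  (h, k) \in scan_path j i ->
  [&& j <= h, h <= ncols lam, k == heights j i h & 0 < k].
Proof. by move/mem_ewis; rewrite mem_bottoms. Qed.

(** A path takes at most one box from column [l], its bottom, so membership becomes a jump of the
    height. *)
Lemma scan_pathE j i l k : i < zeta j ->
  ((l, k) \in scan_path j i.+1) = (heights j i l < k <= heights j i.+1 l).
Proof.
move=> lt_i; apply/idP/idP => [Pk|/andP[]].
  have /and4P[_ _ /eqP eq_k k_gt0] := mem_scan_path Pk.
  by rewrite heightsS // -eq_k Pk leqnn andbT prednK.
rewrite heightsS //; case: ifP => [Pl lt_k le_k|_ /leq_trans lt /lt].
  suff -> : k = heights j i.+1 l by [].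
  apply/eqP; rewrite eqn_leq le_k; apply: leq_trans lt_k.
  exact: leqSpred.
by rewrite ltnn.
Qed.

Lemma path_rowP j l k : 0 < j <= l -> box l k ->
  [/\ 0 < path_row j (l, k), path_row j (l, k) <= zeta j
    & (l, k) \in scan_path j (path_row j (l, k))].
Proof.
case/andP=> j_gt0 le_jl; rewrite boxE => /and3P[l_gt0 k_gt0 le_k].
suff hasP : has (fun i => (l, k) \in scan_path j i) (iota 1 (zeta j)).
  have := hasP; rewrite has_find size_iota => lt_find; split=> //.
  by have := nth_find 0 hasP; rewrite nth_iota.
have ex_i : exists i, (i <= zeta j) && (k <= heights j i l).
  by exists (zeta j); rewrite leqnn /Defs.heights subnn /= le_jl.
(* The path sought is the last one to find the box still present. The index 0 is excluded: column
   [j] is then empty, hence so is column [l]. *)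
case: (ex_minnP ex_i) => [[|i]] /andP[le_i ge_k] min_i.
  have [sh0 c0] := heights_shape j_gt0 le_i.
  have := leq_trans ge_k (shape_from_anti sh0 le_jl).
  by rewrite c0 leqNgt k_gt0.
apply/hasP; exists i.+1; first by rewrite mem_iota.
rewrite scan_pathE // ge_k andbT ltnNge; apply/negP => ge_k'.
by have := min_i i; rewrite ge_k' ltnW //= ltnn => /(_ isT).
Qed.

(** As the scan runs downwards, both sides say that the box is still there when path [i] is
    scanned. *)
Lemma path_row_le j l k i : 0 < j <= l -> box l k -> i <= zeta j ->
  (path_row j (l, k) <= i) = (k <= heights j i l).
Proof.
move=> le_jl bk le_i; have [] := path_rowP le_jl bk.
case: (path_row _ _) => // r _ le_r; rewrite scan_pathE // => /andP[lt_k ge_k].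
apply/idP/idP => [le_ri|].
  by apply: leq_trans ge_k _; apply: heights_mono; rewrite le_ri.
apply: contraLR; rewrite -!ltnNge ltnS => le_ir.
by apply: leq_ltn_trans lt_k; apply: heights_mono; rewrite le_ir ltnW.
Qed.

Lemma path_row_unique j l k i : 0 < j -> 0 < i <= zeta j ->
  (l, k) \in scan_path j i -> path_row j (l, k) = i.
Proof.
move=> j_gt0 /andP[]; case: i => // i _ lt_i Pi.
have /and4P[le_jl le_ln /eqP eq_k k_gt0] := mem_scan_path Pi.
have [[_ c_zeta _] _] := heights_shape j_gt0 lt_i.
have bk : box l k by rewrite boxE k_gt0 eq_k c_zeta (leq_trans j_gt0).
have jl : 0 < j <= l by rewrite j_gt0.
move: Pi; rewrite scan_pathE // => /andP[lt_k ge_k].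
apply/eqP; rewrite eqn_leq path_row_le // ge_k ltnNge.
by rewrite path_row_le ?(ltnW lt_i) // -ltnNge.
Qed.

Lemma path_row_diag l k : box l k -> path_row l (l, k) = k.
Proof.
rewrite boxE => /and3P[l_gt0 k_gt0 le_k].
apply: path_row_unique => //; first by rewrite k_gt0.
have [_ eq_k] := heights_shape l_gt0 le_k.
rewrite -{1}eq_k; apply: head_mem_ewis_bottoms; rewrite ?eq_k //.
by rewrite -zeta_gt0 //; apply: leq_trans le_k.
Qed.

(** For [i] in the range and at least [path_row j (l, k)], the bottom of column [l] is [(l, k)], so
    the test on [E_] is exactly membership in path [i]. *)
Lemma path_row_between j l k : 0 < j < l -> box l k ->
  [/\ 0 < a_ lam T l k j <= path_row j (l, k),
      path_row j (l, k) < b_ lam T l k j,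
      E_ lam T l k j (path_row j (l, k)) <= T l k
    & forall i, a_ lam T l k j <= i < b_ lam T l k j ->
        E_ lam T l k j i <= T l k -> i <= path_row j (l, k)].
Proof.
move=> /andP[j_gt0 lt_jl] bk; have jl : 0 < j <= l by rewrite j_gt0 ltnW.
have := bk; rewrite boxE => /and3P[l_gt0 k_gt0 le_k].
have le_ln : l <= ncols lam by rewrite -zeta_gt0 //; apply: leq_trans le_k.
have jl1 : 0 < j <= l.-1 by rewrite j_gt0 -ltnS prednK.
have bk1 : box l.-1 k.
  have l1_gt0 : 0 < l.-1 by case/andP: jl1; apply: leq_trans.
  by rewrite boxE l1_gt0 k_gt0 (leq_trans le_k) // zeta_anti // leq_pred.
have [r_gt0 le_r Pr] := path_rowP jl bk.
have [a_gt0 _ _] := path_rowP jl1 bk1.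
(* The bound [b_] says that [(l, k.+1)] has already been removed, or lies outside the shape. *)
have heights_k i : i <= zeta j -> k <= heights j i l ->
    i < b_ lam T l k j -> heights j i l = k.
  move=> le_i ge_k lt_ib; apply/eqP; rewrite eqn_leq ge_k andbT.
  move: lt_ib; rewrite /b_ ltn_eqF //; case: ifP => [lt_k|ge_kz].
    have bkS : box l k.+1 by rewrite boxE l_gt0.
    by rewrite ltnNge path_row_le // -ltnNge.
  move=> _; have [[_ c_zeta _] _] := heights_shape j_gt0 le_i.
  by apply: leq_trans (c_zeta l) _; rewrite leqNgt ge_kz.
have EE i : 0 < i <= zeta j -> heights j i l = k ->
    (E_ lam T l k j i <= T l k) = ((l, k) \in scan_path j i).
  case/andP=> i_gt0 le_i eq_k; have [_ cj] := heights_shape j_gt0 le_i.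
  have := @mem_ewis_bottoms j (heights j i) l.
  by rewrite cj eq_k lt_jl le_ln /E_ ltn_eqF // => -> .
have r_k : heights j (path_row j (l, k)) l = k.
  by have /and4P[_ _ /eqP] := mem_scan_path Pr.
split=> [|||i].
(* When the path through [(l, k)] is scanned, column [l.-1] is at least as high as column [l], so
   [(l.-1, k)] is still present. *)
- rewrite /a_ ltn_eqF // a_gt0 path_row_le // -{1}r_k.
  have [[_ _ c_anti] _] := heights_shape j_gt0 le_r.
  by have := c_anti l.-1; rewrite prednK //; apply; case/andP: jl1.
- rewrite /b_ ltn_eqF //; case: ifP => // lt_k.
  have bkS : box l k.+1 by rewrite boxE l_gt0.
  by rewrite ltnNge path_row_le // r_k ltnn.
- by rewrite EE ?r_gt0.
(* A larger [i] would be scanned earlier with [(l, k)] at the bottom and would remove it, against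
   the uniqueness of its path. *)
case/andP=> ge_a lt_b le_E; rewrite leqNgt; apply/negP => lt_ri.
have le_i : i <= zeta j.
  move: lt_b; rewrite /b_ ltn_eqF //; case: ifP => // lt_k lt_b.
  have bkS : box l k.+1 by rewrite boxE l_gt0.
  by have [_ + _] := path_rowP jl bkS; apply: leq_trans; apply: ltnW.
have i_k : heights j i l = k.
  by apply: heights_k; rewrite // -path_row_le // ltnW.
have i_gt0 : 0 < i by apply: leq_trans lt_ri.
move: le_E; rewrite EE ?i_gt0 // => /(path_row_unique j_gt0) eq_ri.
by move: lt_ri; rewrite eq_ri ?ltnn // i_gt0.
Qed.

(** * Both conditions expressed through [path_row] *)

Lemma scanning_leP (Y : filling) :
  tab_le lam (scanning lam T) Y <->
  forall l k j, 0 < j <= l -> box l k -> T l k <= Y j (path_row j (l, k)).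
Proof.
split=> [le_SY l k j jl bk|le_TY j i bi].
  have [r_gt0 le_r Pr] := path_rowP jl bk; have /andP[j_gt0 _] := jl.
  apply: leq_trans (le_SY _ _ _); last by rewrite boxE j_gt0 r_gt0.
  exact: (sorted_le_last (v := value) _ (sorted_ewis _ _) Pr).
have := bi; rewrite boxE => /and3P[j_gt0 i_gt0 le_i].
have [_ eq_i] := heights_shape j_gt0 le_i.
have le_jn : j <= ncols lam by rewrite -zeta_gt0 //; apply: leq_trans le_i.
have head_P : (j, i) \in scan_path j i.
  by rewrite -{1}eq_i; apply: head_mem_ewis_bottoms; rewrite ?eq_i.
(* The hypothesis is applied to the last box of the path, whose value is the scanning entry. *)
have : last (0, 0) (scan_path j i) \in scan_path j i.
  exact: (mem_last_of _ head_P).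
rewrite /scanning; case: (last _ _) => h k Phk.
have /and4P[le_jh _ /eqP eq_k k_gt0] := mem_scan_path Phk.
have [[_ c_zeta _] _] := heights_shape j_gt0 le_i.
have bhk : box h k by rewrite boxE k_gt0 eq_k c_zeta (leq_trans j_gt0).
have <- : path_row j (h, k) = i by apply: path_row_unique; rewrite ?i_gt0.
by apply: le_TY; rewrite ?j_gt0.
Qed.

Lemma key_mono (pi : n.-tuple nat) j i i' :
  0 < i <= i' -> i' <= zeta j -> key lam pi j i <= key lam pi j i'.
Proof.
case/andP=> i_gt0 le_i le_i'; rewrite /key.
(* Keeps both positions inside the list: [zeta j] counts parts of an [n]-tuple, so [take] finds
   enough entries. *)
have sz : size (sort leq (take (zeta j) pi)) = zeta j.
  have le_n : zeta j <= n by rewrite -[X in _ <= X](size_tuple lam) count_size.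
  by rewrite size_sort size_take_min size_tuple; apply/minn_idPl.
apply: (sorted_leq_nth leq_trans leqnn) => //.
- exact: sort_sorted leq_total _.
- by rewrite inE sz; case: i i_gt0 le_i => // i _ /leq_trans->.
- by rewrite inE sz; case: i' le_i le_i' => //; case: i i_gt0.
by rewrite -!subn1 leq_sub2r.
Qed.

(** For [j < l], an interval containing [T l k] has index at most that of the path through the box,
    and [key_mono] raises the bound to that index; conversely that index is a witness. For [j = l]
    the only index is [k], the path's own. *)
Lemma mem_B (pi : n.-tuple nat) l k : box l k ->
  T l k \in B_ lam T pi l k <->
  forall j, 0 < j <= l -> T l k <= key lam pi j (path_row j (l, k)).
Proof.
move=> bk; split=> [/allP memB j jl|le_TY].
  have /andP[j_gt0 le_jl] := jl.
  have /memB/hasP[i] : j \in index_iota 1 l.+1 by rewrite mem_index_iota.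
  rewrite mem_index_iota => i_ab /andP[le_E le_Y].
  move: i_ab le_E le_Y; case: (ltngtP j l) le_jl => // [lt_jl|->] _.
    have jl' : 0 < j < l by rewrite j_gt0.
    have [/andP[a_gt0 _] _ _ max_r] := path_row_between jl' bk.
    move=> i_ab le_E le_Y; apply: leq_trans le_Y _; apply: key_mono.
      by rewrite max_r // andbT; case/andP: i_ab => /(leq_trans a_gt0).
    by have [] := path_rowP jl bk.
  by rewrite /a_ /b_ eqxx ltnS -eqn_leq path_row_diag // => /eqP -> _.
apply/allP => j; rewrite mem_index_iota ltnS => jl.
apply/hasP; exists (path_row j (l, k)); last rewrite le_TY // andbT.
all: have /andP[j_gt0] := jl; rewrite ?mem_index_iota leq_eqVlt.
all: case/predU1P=> [eq_jl|lt_jl].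
- by rewrite /a_ /b_ eq_jl eqxx path_row_diag ?leqnn.
- have jl' : 0 < j < l by rewrite j_gt0.
  by have [/andP[_ ->] -> _ _] := path_row_between jl' bk.
- by rewrite /E_ eq_jl eqxx row_le_value.
have jl' : 0 < j < l by rewrite j_gt0.
by have [_ _ -> _] := path_row_between jl' bk.
Qed.

End Scan.

Theorem theorem8p1 (n : nat) (lam : n.-tuple nat) (pi : n.-tuple nat)
    (T : filling) (hn : 0 < n) (hlam : is_partition lam) (hpi : in_Sn pi)
    (hT : semistandard lam T) :
  tab_le lam (scanning lam T) (key lam pi) <->
  (forall l k : nat, box lam l k -> T l k \in B_ lam T pi l k).
Proof.
have [le_box box_le] := scanning_leP hlam hT (key lam pi).
split=> [le_SY l k bk | memB].
  by apply/(mem_B hlam hT) => // j jl; apply: le_box.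
by apply: box_le => l k j jl bk; have /(mem_B hlam hT) := memB l k bk; apply.
Qed.
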